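(* Let $r$ be a positive integer, $k\in\mathbb Z$, and $a_1,\dots,a_r$ nonzero complex numbers. Then for every integer $n\ge1$, \begin{align*} S_n^{(r,k)}(x|a_1,\dots,a_r)&=xS_{n-1}^{(r,k)}(x|a_1,\dots,a_r)+\sum_{m=1}^n\frac{(-1)^{m-1}\binom{n-1}{m-1}B_m}{m}\sum_{j=1}^r a_j^mS_{n-m}^{(r,k)}(x|a_1,\dots,a_r)\\ &\quad+\frac1nS_n^{(r+1,k-1)}(x|a_1,\dots,a_r,1)-\frac1nS_n^{(r+1,k)}(x|a_1,\dots,a_r,1), \end{align*} where $B_m$ denotes the $m$th ordinary Bernoulli number.
   Context: For an integer $k$, ${\rm Li}_k(x)=\sum_{m=1}^\infty x^m/m^k$. For $r\in\mathbb Z_{>0}$, $k\in\mathbb Z$ and nonzero complex $a_1,\dots,a_r$, the polynomials $S_n^{(r,k)}(x|a_1,\dots,a_r)$ are defined by $\frac{t^r}{\prod_{j=1}^r(e^{a_jt}-1)}\frac{{\rm Li}_k(1-e^{-t})}{1-e^{-t}}e^{xt}=\sum_{n\ge0}S_n^{(r,k)}(x|a_1,\dots,a_r)\frac{t^n}{n!}$; thus $S_n^{(r+1,k')}(x|a_1,\dots,a_r,1)$ is the same with $r+1$ parameters, $a_{r+1}=1$ and $k'$ in place of $k$. Ordinary Bernoulli numbers: $\frac{t}{e^t-1}=\sum_{n\ge0}B_n\frac{t^n}{n!}$. *)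

(* Defs.v *)
From HB Require Import structures.
From mathcomp Require Import all_boot all_order all_algebra.
From mathcomp Require Import boolp classical_sets.

Set Implicit Arguments.
Unset Strict Implicit.
Unset Printing Implicit Defensive.

Import GRing.Theory.
Local Open Scope ring_scope.

Record fps (R : Type) := Fps { fcoef :> nat -> R }.

Lemma fpsP (R : Type) (f g : fps R) : f =1 g -> f = g.
Proof. by case: f g => [f] [g] /= /funext ->. Qed.

HB.instance Definition _ (R : Type) := gen_eqMixin (fps R).
HB.instance Definition _ (R : Type) := gen_choiceMixin (fps R).

Section FpsZmodule.
Variable R : zmodType.

Let zero : fps R := Fps (fun=> 0).
Let opp (f : fps R) : fps R := Fps (fun n => - f n).
Let add (f g : fps R) : fps R := Fps (fun n => f n + g n).

Fact fps_addA : associative add.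
Proof. by move=> f g h; apply: fpsP => n /=; rewrite addrA. Qed.

Fact fps_addC : commutative add.
Proof. by move=> f g; apply: fpsP => n /=; rewrite addrC. Qed.

Fact fps_add0 : left_id zero add.
Proof. by move=> f; apply: fpsP => n /=; rewrite add0r. Qed.

Fact fps_addN : left_inverse zero opp add.
Proof. by move=> f; apply: fpsP => n /=; rewrite addNr. Qed.

HB.instance Definition _ :=
  GRing.isZmodule.Build (fps R) fps_addA fps_addC fps_add0 fps_addN.

Lemma fcoef0 n : (0 : fps R) n = 0. Proof. by []. Qed.
Lemma fcoefN (f : fps R) n : (- f) n = - f n. Proof. by []. Qed.
Lemma fcoefD (f g : fps R) n : (f + g) n = f n + g n. Proof. by []. Qed.
Lemma fcoefB (f g : fps R) n : (f - g) n = f n - g n. Proof. by []. Qed.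

End FpsZmodule.

Section FpsRing.
Variable R : comNzRingType.

Let one : fps R := Fps (fun n => (n == 0%N)%:R).
Let mul (f g : fps R) : fps R := Fps (fun n => \sum_(i < n.+1) f i * g (n - i)%N).

Let trunc N (f : fps R) : {poly R} := \poly_(i < N) f i.

Let mul_trunc N (f g : fps R) n : (n < N)%N ->
  mul f g n = (trunc N f * trunc N g)`_n.
Proof.
move=> ltnN; rewrite coefM; apply: eq_bigr => i _.
have leiN : (i < N)%N by apply: leq_ltn_trans ltnN; rewrite -ltnS.
by rewrite !coef_poly leiN (leq_ltn_trans (leq_subr _ _) ltnN).
Qed.

Fact fps_mulC : commutative mul.
Proof. by move=> f g; apply: fpsP => n; rewrite !(@mul_trunc n.+1) // mulrC. Qed.

Fact fps_mulA : associative mul.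
Proof.
move=> f g h; apply: fpsP => n.
transitivity ((trunc n.+1 f * (trunc n.+1 g * trunc n.+1 h))`_n).
  rewrite (@mul_trunc n.+1) // !coefM; apply: eq_bigr => i _; congr (_ * _).
  have ltn : (n - i < n.+1)%N by rewrite ltnS leq_subr.
  by rewrite -mul_trunc // coef_poly ltn.
rewrite mulrA (@mul_trunc n.+1) // !coefM.
apply: eq_bigr => i _; congr (_ * _).
by rewrite -mul_trunc // coef_poly ltn_ord.
Qed.

Fact fps_mul1 : left_id one mul.
Proof.
move=> f; apply: fpsP => n /=.
by rewrite big_ord_recl /= mul1r subn0 big1 ?addr0 // => i _; rewrite mul0r.
Qed.

Fact fps_mulD : left_distributive mul +%R.
Proof.
move=> f g h; apply: fpsP => n; rewrite fcoefD /= -big_split /=.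
by apply: eq_bigr => i _; rewrite mulrDl.
Qed.

Fact fps_oner_neq0 : one != 0.
Proof.
by apply/eqP => /(congr1 (fun f : fps R => f 0%N)) /eqP; rewrite /= oner_eq0.
Qed.

HB.instance Definition _ := GRing.Zmodule_isComNzRing.Build (fps R)
  fps_mulA fps_mulC fps_mul1 fps_mulD fps_oner_neq0.

Lemma fcoef1 n : (1 : fps R) n = (n == 0%N)%:R. Proof. by []. Qed.
Lemma fcoefM (f g : fps R) n : (f * g) n = \sum_(i < n.+1) f i * g (n - i)%N.
Proof. by []. Qed.

Definition fvar : fps R := Fps (fun n => (n == 1%N)%:R).

(** Substitution [f (g (t))]; it is the usual infinite sum [\sum_m f_m g^m] only
    when [g 0 = 0], in which case [g ^+ m] does not contribute below [t^m]. *)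
Definition fcomp (f g : fps R) : fps R :=
  Fps (fun n => \sum_(m < n.+1) f m * (g ^+ m) n).

(** The quotient [f / g] as the solution [q] of [g q = f], with [g 0] allowed to
    vanish. See [fdiv_unique] and [fdiv_exists] for uniqueness and existence. *)
Definition fdiv (f g : fps R) : fps R := xget 0 [set q | g * q = f]%classic.

End FpsRing.

Section FpsSeries.
Variable R : comUnitRingType.

(** [e^(u t)]; used only when all positive integers are invertible in [R]. *)
Definition fexp (u : R) : fps R := Fps (fun n => u ^+ n / n`!%:R).

(** [Li_k (t) = \sum_(m >= 1) t^m / m^k], for [k] of any sign. *)
Definition fLi (k : int) : fps R :=
  Fps (fun m => if m == 0%N then 0 else (m%:R ^ k)^-1).

End FpsSeries.

Definition bernoulli (C : fieldType) (n : nat) : C :=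
  n`!%:R * fdiv (fvar C) (fexp 1 - 1) n.

Section BarnesPolyBernoulli.
Variables (C : fieldType) (r : nat).

(** Series in [t] with coefficients in [C[x]], the variable [x] being ['X]. *)
Definition barnesS_genfun (k : int) (a : r.-tuple C) : fps {poly C} :=
  let u := 1 - fexp (-1) in
  fdiv (fvar _ ^+ r) (\prod_(j < r) (fexp (tnth a j)%:P - 1))
  * fdiv (fcomp (fLi _ k) u) u
  * fexp 'X.

Definition barnesS (k : int) (a : r.-tuple C) (n : nat) : {poly C} :=
  n`!%:R * barnesS_genfun k a n.

End BarnesPolyBernoulli.

Section FpsDivision.
Variable R : comUnitRingType.
Implicit Types f g q : fps R.

Definition fvanish f d := forall i, (i < d)%N -> f i = 0.

Lemma fcoefM_vanish f g d e n : fvanish f d -> fvanish g e -> (n <= d + e)%N ->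
  (f * g) n = if n == (d + e)%N then f d * g e else 0.
Proof.
move=> fd ge len; rewrite fcoefM; case: eqP => [->|/eqP nen].
  rewrite (bigD1 (inord d)) //= inordK ?ltnS ?leq_addr // addKn big1 ?addr0 //.
  move=> i; rewrite -val_eqE /= inordK ?ltnS ?leq_addr // neq_ltn.
  case/orP => lt; first by rewrite fd ?mul0r.
  rewrite (ge (d + e - i)%N) ?mulr0 // ltn_subLR ?ltn_add2r //.
  by rewrite -ltnS ltn_ord.
have ltn : (n < d + e)%N by rewrite ltn_neqAle nen.
rewrite big1 // => i _; case: (ltnP i d) => [/fd->|led]; first by rewrite mul0r.
rewrite (ge (n - i)%N) ?mulr0 // ltn_subLR ?(leq_trans ltn) ?leq_add2r //.
by rewrite -ltnS.
Qed.

Lemma fmul_inj g d q1 q2 : fvanish g d -> g d \is a GRing.unit ->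
  g * q1 = g * q2 -> q1 = q2.
Proof.
move=> gd gu /eqP; rewrite -subr_eq0 -mulrBr => /eqP gq.
apply/eqP; rewrite -subr_eq0; apply/eqP/fpsP; set q := q1 - q2 in gq *.
elim/ltn_ind => n IHn; apply: (mulrI gu).
have := @fcoefM_vanish g q d n (d + n) gd IHn (leqnn _).
by rewrite eqxx gq => <-; rewrite !fcoef0 mulr0.
Qed.

Lemma fdiv_unique f g d q : fvanish g d -> g d \is a GRing.unit ->
  g * q = f -> fdiv f g = q.
Proof.
move=> gd gu gq; apply: xget_unique => // q'; rewrite /= -gq.
exact: fmul_inj gd gu.
Qed.

Lemma fdiv_exists f g d : fvanish g d -> g d \is a GRing.unit ->
  fvanish f d -> g * fdiv f g = f.
Proof.
move=> gd gu fd; apply: (@xgetPex _ 0 [set q | g * q = f]%classic).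
pose next s := let n := size s in
  (f (d + n)%N - \sum_(i < n) g (d + n - i)%N * s`_i) / g d.
pose qs := fix qs n := if n is m.+1 then rcons (qs m) (next (qs m)) else [::].
have size_qs n : size (qs n) = n by elim: n => //= n IHn; rewrite size_rcons IHn.
pose q : fps R := Fps (fun n => next (qs n)).
have nth_qs n i : (i < n)%N -> (qs n)`_i = q i.
  elim: n => //= n IHn; rewrite ltnS nth_rcons size_qs leq_eqVlt.
  by case/predU1P => [->|ltin]; rewrite ?ltnn ?eqxx // ltin IHn.
exists q; apply: fpsP => m; case: (ltnP m d) => [ltmd|ledm].
  rewrite (@fcoefM_vanish g q d 0) ?addn0 ?(ltnW ltmd) // fd //.
  by rewrite ltn_eqF.
rewrite -(subnKC ledm); move: (m - d)%N => n.
rewrite mulrC fcoefM -(big_mkord predT (fun i => q i * g (d + n - i)%N)).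
rewrite (big_cat_nat (n := n.+1)) //= ?ltnS ?leq_addl //.
rewrite [X in _ + X]big_nat_cond [X in _ + X]big1 => [|i]; last first.
  rewrite andbT => /andP[ltni leid]; rewrite (gd (d + n - i)%N) ?mulr0 //.
  by rewrite ltn_subLR // (addnC d n) ltn_add2r.
rewrite addr0 big_nat_recr //= addnK /next size_qs divrK // addrC.
rewrite big_mkord.
rewrite [X in _ - X + _](eq_bigr (fun i : 'I_n => q i * g (d + n - i)%N)).
  by rewrite subrK.
by move=> i _; rewrite nth_qs // mulrC.
Qed.

Lemma fvanish_prod r (g : 'I_r -> fps R) : (forall j, g j 0%N = 0) ->
  fvanish (\prod_j g j) r /\ (\prod_j g j) r = \prod_j g j 1%N.
Proof.
elim: r g => [|r IHr] g g0; first by rewrite !big_ord0.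
rewrite !big_ord_recr.
have [//|v1 c1] := IHr (fun j => g (widen_ord (leqnSn r) j)).
have v2 : fvanish (g ord_max) 1 by case=> // _; apply: g0.
split=> [i lt|].
  rewrite (fcoefM_vanish v1 v2) ?addn1 1?ltnW // ltn_eqF //.
by rewrite (fcoefM_vanish v1 v2) ?addn1 // eqxx c1.
Qed.

Lemma fexp_coef0 (u : R) : fexp u 0 = 1.
Proof. by rewrite /= divr1. Qed.

Lemma fexp_coef1 (u : R) : fexp u 1 = u.
Proof. by rewrite /= expr1 divr1. Qed.

End FpsDivision.

(** The defining identity of the [bernoulli n] with denominators cleared. *)
Lemma bernoulliP (C : fieldType) :
  (fexp 1 - 1) * fdiv (fvar C) (fexp 1 - 1) = fvar C.
Proof.
apply: (@fdiv_exists _ _ _ 1); last by case.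
  by case=> // _; rewrite fcoefB fexp_coef0 subrr.
by rewrite fcoefB fexp_coef1 subr0 unitr1.
Qed.

(** The defining identity of the [barnesS k a n] with denominators cleared. *)
Lemma barnesS_genfunP (C : fieldType) (r : nat) (k : int) (a : r.-tuple C) :
    (forall j, tnth a j != 0) ->
  \prod_(j < r) (fexp (tnth a j)%:P - 1) * (1 - fexp (-1)) * barnesS_genfun k a
  = fvar {poly C} ^+ r * fcomp (fLi _ k) (1 - fexp (-1)) * fexp 'X.
Proof.
move=> a0; rewrite /barnesS_genfun; set P := \prod_(j < r) _; set u := 1 - _.
have [vP cP] : fvanish P r /\ P r = \prod_(j < r) (tnth a j)%:P.
  have [|v c] := fvanish_prod (g := fun j => fexp (tnth a j)%:P - 1).
    by move=> j; rewrite fcoefB fexp_coef0 subrr.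
  by split=> //; rewrite c; apply: eq_bigr => j _; rewrite fcoefB fexp_coef1 subr0.
have vt : fvanish (fvar {poly C} ^+ r) r.
  rewrite -[X in _ ^+ X]card_ord -prodr_const.
  by have [] := @fvanish_prod _ r (fun=> fvar {poly C}) (fun=> erefl).
have EP : P * fdiv (fvar _ ^+ r) P = fvar _ ^+ r.
  apply: fdiv_exists vP _ vt; rewrite cP -rmorph_prod /= poly_unitE.
  have nz : \prod_(j < r) tnth a j != 0 by apply/prodf_neq0 => j _.
  by rewrite size_polyC coefC nz eqxx unitfE.
have Eu : u * fdiv (fcomp (fLi _ k) u) u = fcomp (fLi _ k) u.
  apply: (@fdiv_exists _ _ _ 1).
  - by case=> // _; rewrite fcoefB fexp_coef0 subrr.
  - by rewrite fcoefB fexp_coef1 sub0r opprK unitr1.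
  - by case=> // _; rewrite /= big_ord_recl big_ord0 mul0r addr0.
by rewrite -[in RHS]EP -[in RHS]Eu !mulrA; congr (_ * _ * _); rewrite mulrAC.
Qed.

(* Main.v *)
(** With the Euler derivation [theta = t d/dt], the generating function
    [G = (\prod_j beta_j) Q_k e^(xt)], where [beta_j = t / (e^(a_j t) - 1)],
    [u = 1 - e^(-t)] and [Q_k = Li_k(u) / u], is differentiated factor by factor:
    [theta e^(xt) = x t e^(xt)], [theta beta_j = (1 - B(- a_j t)) beta_j] with
    [B(t) = t / (e^t - 1)], and [theta Q_k = B(t) (Q_(k-1) - Q_k)] because
    [theta Li_k = Li_(k-1)] and [t u' / u = B(t)].  Multiplication by [B(t)] appends
    the parameter [1] to [a].  The recurrence is the coefficient of [t^n] in the
    resulting expression for [theta G]. *)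
Require Import Defs.
From mathcomp Require Import all_boot all_order all_algebra reals.
From mathcomp Require Import complex ring.
Import GRing.Theory.
Local Open Scope ring_scope.

(** * Euler derivation and chain rule for formal power series *)

Section FpsTheory.
Context {R : comNzRingType}.
Implicit Types f g h : fps R.

Definition fconst (c : R) : fps R := Fps (fun n => if n == 0%N then c else 0).

Lemma fcoef_constM c f n : (fconst c * f) n = c * f n.
Proof.
rewrite fcoefM big_ord_recl /= subn0 big1 ?addr0 // => i _.
by rewrite mul0r.
Qed.

Lemma fcoef_varM f n : (fvar R * f) n = if n == 0%N then 0 else f n.-1.
Proof.
rewrite fcoefM; case: n => [|n]; first by rewrite big_ord1 mul0r.
rewrite big_ord_recl /= mul0r add0r big_ord_recl /= mul1r subSS subn0.
by rewrite big1 ?addr0 // => i _; rewrite mul0r.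
Qed.

Lemma fcoef_sum I (s : seq I) (F : I -> fps R) n :
  (\sum_(i <- s) F i) n = \sum_(i <- s) F i n.
Proof.
by elim: s => [|i s IHs]; rewrite ?big_nil // !big_cons fcoefD IHs.
Qed.

Definition ftheta f : fps R := Fps (fun n => n%:R * f n).

Lemma fthetaD f g : ftheta (f + g) = ftheta f + ftheta g.
Proof. by apply: fpsP => n /=; rewrite mulrDr. Qed.

Lemma fthetaN f : ftheta (- f) = - ftheta f.
Proof. by apply: fpsP => n /=; rewrite mulrN. Qed.

Lemma ftheta1 : ftheta 1 = 0.
Proof. by apply: fpsP => -[|n] /=; rewrite ?mul0r ?mulr0. Qed.

Lemma ftheta_var : ftheta (fvar R) = fvar R.
Proof. by apply: fpsP => -[|[|n]] /=; rewrite ?mul0r ?mulr0 ?mulr1. Qed.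

Lemma fthetaM f g : ftheta (f * g) = ftheta f * g + f * ftheta g.
Proof.
apply: fpsP => n; rewrite fcoefD !fcoefM /= -big_split /= mulr_sumr.
apply: eq_bigr => i _; have lein : (i <= n)%N by rewrite -ltnS.
by rewrite natrB //; ring.
Qed.

(** Logarithmic derivatives of the factors add up; [W j] plays that role without any division. *)
Lemma ftheta_prod r (F W : 'I_r -> fps R) :
    (forall j, ftheta (F j) = W j * F j) ->
  ftheta (\prod_j F j) = (\sum_j W j) * \prod_j F j.
Proof.
elim: r F W => [|r IHr] F W FW; first by rewrite !big_ord0 ftheta1 mul0r.
rewrite !big_ord_recr /= fthetaM (IHr _ (fun j => W (widen_ord (leqnSn r) j))) //.
by rewrite FW; ring.
Qed.

(** The power rule, multiplied by [g] so that the exponent m - 1 never appears and m = 0 is no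
    exception. *)
Lemma mul_fthetaX g m : g * ftheta (g ^+ m) = fconst m%:R * g ^+ m * ftheta g.
Proof.
have natS i : fconst i.+1%:R = 1 + fconst i%:R.
  by apply: fpsP => -[|n]; rewrite fcoefD /= ?addr0 // -natr1 addrC.
elim: m => [|m IHm].
  have -> : fconst 0 = 0 by apply: fpsP => -[].
  by rewrite ftheta1 mulr0 !mul0r.
by rewrite exprS fthetaM mulrDr mulrCA IHm natS; ring.
Qed.

Lemma fvanishX g m : g 0%N = 0 -> forall i, (i < m)%N -> (g ^+ m) i = 0.
Proof.
move=> g0; elim: m => // m IHm i lt_im; rewrite exprS fcoefM big1 // => -[j lt_ji] _ /=.
case: j lt_ji => [|j] lt_ji; first by rewrite g0 mul0r.
rewrite IHm ?mulr0 //; case: i lt_im lt_ji => // i lt_im _.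
by rewrite subSS (leq_ltn_trans (leq_subr _ _)).
Qed.

Lemma fcoef_comp_trunc f g N n : g 0%N = 0 -> (n < N)%N ->
  fcomp f g n = (\sum_(m < N) fconst (f m) * g ^+ m) n.
Proof.
move=> g0 lt_nN; rewrite fcoef_sum [LHS]/=.
under [RHS]eq_bigr do rewrite fcoef_constM.
rewrite -(big_mkord predT (fun m => f m * (g ^+ m) n)).
rewrite -(big_mkord predT (fun m => f m * (g ^+ m) n)).
rewrite [RHS](big_cat_nat (n := n.+1)) //=.
rewrite [X in _ + X]big_nat_cond [X in _ + X]big1 ?addr0 // => m.
by rewrite andbT => /andP[lt_nm _]; rewrite fvanishX ?mulr0.
Qed.

(** Chain rule theta (f(g)) = f'(g) theta g; the extra factor [g] turns f'(g) into (theta f)(g). *)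
Lemma ftheta_comp f g : g 0%N = 0 ->
  g * ftheta (fcomp f g) = fcomp (ftheta f) g * ftheta g.
Proof.
move=> g0; apply: fpsP => n.
(* Only coefficients up to degree n enter, and there substitution agrees with this finite sum, to
   which the power rule applies termwise. *)
pose trunc h : fps R := \sum_(m < n.+1) fconst (h m) * g ^+ m.
have truncE h i : (i < n.+1)%N -> fcomp h g i = trunc h i.
  exact: fcoef_comp_trunc.
transitivity ((g * ftheta (trunc f)) n).
  rewrite !fcoefM; apply: eq_bigr => i _; congr (_ * _).
  by rewrite [LHS]/= [RHS]/= -truncE // ltnS leq_subr.
transitivity ((trunc (ftheta f) * ftheta g) n); last first.
  by rewrite !fcoefM; apply: eq_bigr => i _; rewrite truncE.
congr (fcoef _ n); rewrite /trunc mulr_suml.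
have ftheta_sum (F : 'I_n.+1 -> fps R) :
    ftheta (\sum_m F m) = \sum_m ftheta (F m).
  apply: fpsP => i; rewrite fcoef_sum [LHS]/= fcoef_sum mulr_sumr.
  by apply: eq_bigr.
rewrite ftheta_sum mulr_sumr; apply: eq_bigr => m _.
have -> : ftheta (fconst (f m) * g ^+ m) = fconst (f m) * ftheta (g ^+ m).
  apply: fpsP => i; rewrite fcoef_constM [RHS]mulrCA.
  by congr (_ * _); apply: fcoef_constM.
rewrite mulrCA mul_fthetaX !mulrA; congr (_ * _ * _).
by apply: fpsP => -[|i]; rewrite fcoef_constM /= ?mulr0 // mulrC.
Qed.

End FpsTheory.

(** * Exponential and polylogarithm series when positive integers are invertible *)

Section FpsExp.
Context {R : comUnitRingType}.
Hypothesis natS_unit : forall n, n.+1%:R \is a @GRing.unit R.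

Lemma fact_unit n : n`!%:R \is a @GRing.unit R.
Proof. by case: n`! (fact_gt0 n) => // m _; apply: natS_unit. Qed.

Lemma fexpD (u v : R) : fexp (u + v) = fexp u * fexp v.
Proof.
apply: fpsP => n; rewrite fcoefM /= addrC exprDn mulr_suml.
apply: eq_bigr => i _; have lein : (i <= n)%N by rewrite -ltnS.
apply: (mulIr (fact_unit n)); rewrite divrK ?fact_unit // -(bin_fact lein).
rewrite !natrM -[_ *+ 'C(_, _)]mulr_natr.
have := divrr (fact_unit i); have := divrr (fact_unit (n - i)).
set p := (i`!)%:R; set q := ((n - i)`!)%:R; move: p^-1 q^-1 => p' q' qq pp.
(* The inverse factorials are now variables [p'], [q'], known only through p p' = q q' = 1. *)
transitivity (u ^+ i * v ^+ (n - i) * 'C(n, i)%:R * (p * p') * (q * q')).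
  by rewrite pp qq; ring.
by ring.
Qed.

Lemma fexpVN (u : R) : fexp u * fexp (- u) = 1.
Proof.
by rewrite -fexpD subrr; apply: fpsP => -[|n] /=; rewrite ?expr0 ?divr1 // expr0n mul0r.
Qed.

Lemma ftheta_exp (u : R) : ftheta (fexp u) = fconst u * fvar R * fexp u.
Proof.
apply: fpsP => -[|n]; rewrite -mulrA fcoef_constM fcoef_varM /= ?mul0r ?mulr0 //.
rewrite factS natrM invrM ?natS_unit ?fact_unit // exprS.
rewrite [LHS]mulrC mulrA divrK ?natS_unit //.
by rewrite mulrA.
Qed.

Lemma ftheta_Li (k : int) : ftheta (fLi R k) = fLi R (k - 1).
Proof.
apply: fpsP => -[|n] /=; first by rewrite mul0r.
by rewrite exprzDr ?natS_unit // exprN1 invrM ?unitrXz ?unitrV ?natS_unit // invrK.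
Qed.

End FpsExp.

(** * Cancellation of series of order one *)

Section Barnes.
Context {C : fieldType}.
Hypothesis natS_neq0 : forall n, n.+1%:R != 0 :> C.
Implicit Types (b : C) (k : int).

Lemma polyC_unit b : b != 0 -> b%:P \is a @GRing.unit {poly C}.
Proof. by move=> b0; apply: rmorph_unit; rewrite unitfE. Qed.

Lemma poly_natS_unit n : n.+1%:R \is a @GRing.unit {poly C}.
Proof. by rewrite -polyC_natr polyC_unit. Qed.

Notation u := (1 - fexp (-1) : fps {poly C}).

(** The series e^(bt) - 1 is not invertible, but its lowest term bt has a unit coefficient.
    Identities between quotients are proved below by clearing this denominator. *)
Lemma fexpB1_cancel b (f g : fps {poly C}) : b != 0 ->
  (fexp b%:P - 1) * f = (fexp b%:P - 1) * g -> f = g.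
Proof.
move=> b0; apply: (@fmul_inj _ _ 1).
  by case=> // _; rewrite fcoefB fexp_coef0 subrr.
by rewrite fcoefB fexp_coef1 subr0 polyC_unit.
Qed.

Lemma u_coef0 : u 0%N = 0. Proof. by rewrite fcoefB fexp_coef0 subrr. Qed.

Lemma u_coef1_unit : u 1%N \is a GRing.unit.
Proof. by rewrite fcoefB fexp_coef1 sub0r opprK unitr1. Qed.

Lemma u_cancel (f g : fps {poly C}) : u * f = u * g -> f = g.
Proof.
apply: (@fmul_inj _ _ 1); last exact: u_coef1_unit.
by case=> // _; apply: u_coef0.
Qed.

(** * Bernoulli factors and their Euler derivative *)

Definition bernF b : fps {poly C} := fdiv (fvar _) (fexp b%:P - 1).

Lemma bernFP b : b != 0 -> (fexp b%:P - 1) * bernF b = fvar _.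
Proof.
move=> b0; apply: (@fdiv_exists _ _ _ 1); last by case.
  by case=> // _; rewrite fcoefB fexp_coef0 subrr.
by rewrite fcoefB fexp_coef1 subr0 polyC_unit.
Qed.

(** The substitution [t := b t], followed by the inclusion of [C] in [C[x]]. *)
Definition fscale b (f : fps C) : fps {poly C} := Fps (fun n => (b ^+ n * f n)%:P).

Lemma fscaleM b f g : fscale b (f * g) = fscale b f * fscale b g.
Proof.
apply: fpsP => n; rewrite fcoefM /= mulr_sumr rmorph_sum /=.
apply: eq_bigr => i _; rewrite -polyCM; congr _%:P.
have lein : (i <= n)%N by rewrite -ltnS.
by rewrite -[in b ^+ n](subnKC lein) exprD; ring.
Qed.

Lemma fscale_fexpB1 b : fscale b (fexp 1 - 1) = fexp b%:P - 1.
Proof.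
apply: fpsP => n; rewrite [LHS]/= !fcoefB mulrBr polyCB expr1n mul1r; congr (_ - _).
  rewrite [RHS]/= polyCM polyC_exp; congr (_ * _).
  by rewrite -polyCV polyC_natr.
by case: n => [|n]; rewrite !fcoef1 /= ?mul1r ?mulr0.
Qed.

(** Multiply numerator and denominator of B(-bt) = -bt / (e^(-bt) - 1) by -e^(bt). *)
Lemma fscale_bernoulli b : b != 0 ->
  fscale (- b) (fdiv (fvar C) (fexp 1 - 1)) = fconst b%:P * fexp b%:P * bernF b.
Proof.
move=> b0; apply: (fexpB1_cancel _ _ _ b0); set B := fscale _ _.
have eB : (fexp (- b)%:P - 1) * B = - (fconst b%:P * fvar _).
  rewrite -fscale_fexpB1 -fscaleM bernoulliP; apply: fpsP => n.
  rewrite fcoefN fcoef_constM /= -polyC_natr -polyCM -polyCN.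
  by case: n => [|[|n]] /=; rewrite ?mulr0 ?oppr0 // expr1 mulNr.
have ee : fexp b%:P * fexp (- b)%:P = 1.
  by rewrite polyCN (fexpVN poly_natS_unit).
transitivity (- fexp b%:P * ((fexp (- b)%:P - 1) * B)).
  rewrite mulrA; congr (_ * _).
  by rewrite -ee; ring: ee.
by rewrite eB -(bernFP _ b0); ring.
Qed.

(** Applying theta to (e^(bt) - 1) beta = t produces the term b t e^(bt) beta, which is (e^(bt) - 1)
    B(-bt). *)
Lemma ftheta_bernF b : b != 0 ->
  ftheta (bernF b)
  = (1 - fscale (- b) (fdiv (fvar C) (fexp 1 - 1))) * bernF b.
Proof.
move=> b0; rewrite fscale_bernoulli //; apply: (fexpB1_cancel _ _ _ b0).
have := congr1 ftheta (bernFP _ b0).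
rewrite fthetaM fthetaD fthetaN ftheta1 subr0 (ftheta_exp poly_natS_unit).
rewrite ftheta_var => E.
rewrite -[LHS](addKr (fconst b%:P * fvar {poly C} * fexp b%:P * bernF b)) E.
by rewrite -(bernFP _ b0); ring.
Qed.

(** * The polylogarithm factor *)

Definition polylogQ k : fps {poly C} := fdiv (fcomp (fLi _ k) u) u.

Lemma polylogQP k : u * polylogQ k = fcomp (fLi _ k) u.
Proof.
apply: (@fdiv_exists _ _ _ 1); last 2 first.
- exact: u_coef1_unit.
- by case=> // _; rewrite /= big_ord_recl big_ord0 mul0r addr0.
by case=> // _; apply: u_coef0.
Qed.

(** Apply the chain rule to u Q_k = Li_k(u). One factor [u] cancels at once, a second one after
    theta u = u B(t) is inserted. *)
Lemma ftheta_polylogQ k :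
  ftheta (polylogQ k) = bernF 1 * (polylogQ (k - 1) - polylogQ k).
Proof.
have E := ftheta_comp (fLi _ k) _ u_coef0.
rewrite (ftheta_Li poly_natS_unit) -!polylogQP fthetaM -!mulrA in E.
move/u_cancel: E => E.
(* Here theta u = t e^(-t), with t = (e^t - 1) B(t) and e^(-t) (e^t - 1) = u. *)
have tu : ftheta u = u * bernF 1.
  rewrite fthetaD fthetaN ftheta1 (ftheta_exp poly_natS_unit) -(bernFP _ (oner_neq0 C)).
  have ee := fexpVN poly_natS_unit 1.
  have -> : fconst (-1) = -1 :> fps {poly C} by apply: fpsP => -[|n] /=; rewrite ?oppr0.
  by ring: ee.
apply: u_cancel; rewrite -[LHS](addKr (ftheta u * polylogQ k)) E tu.
by ring.
Qed.

(** * The generating function and its Euler derivative *)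

(** The product of the beta_j solves the equation defining the quotient, whose solution is unique:
    the denominator has order r and unit leading coefficient, the product of the a_j. *)
Lemma barnesS_genfunE r k (a : r.-tuple C) : (forall j, tnth a j != 0) ->
  barnesS_genfun k a = (\prod_j bernF (tnth a j)) * polylogQ k * fexp 'X.
Proof.
move=> a0; rewrite /barnesS_genfun; congr (_ * _ * _).
have [|v c] := fvanish_prod (g := fun j => fexp (tnth a j)%:P - 1).
  by move=> j; rewrite fcoefB fexp_coef0 subrr.
apply: (fdiv_unique v).
  rewrite c rpred_prod // => j _.
  by rewrite fcoefB fexp_coef1 subr0 polyC_unit.
rewrite -big_split /=; under eq_bigr do rewrite bernFP //.
by rewrite prodr_const card_ord.
Qed.

Lemma barnesS_genfun_rcons1 r k (a : r.-tuple C) : (forall j, tnth a j != 0) ->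
  barnesS_genfun k (rcons_tuple a 1) = bernF 1 * barnesS_genfun k a.
Proof.
move=> a0.
have tl (j : 'I_r) : tnth (rcons_tuple a 1) (widen_ord (leqnSn r) j) = tnth a j.
  by rewrite !(tnth_nth 0) /= nth_rcons size_tuple ltn_ord.
have tr : tnth (rcons_tuple a 1) ord_max = 1.
  by rewrite (tnth_nth 0) /= nth_rcons size_tuple ltnn eqxx.
rewrite !barnesS_genfunE //; last first.
  move=> j; case: (unliftP ord_max j) => [i ->|->]; last by rewrite tr oner_neq0.
  by rewrite (_ : lift _ _ = widen_ord (leqnSn r) i) ?tl //; apply/val_inj/lift_max.
rewrite big_ord_recr /= tr; under eq_bigr do rewrite tl.
by ring.
Qed.

Lemma ftheta_barnesS_genfun r k (a : r.-tuple C) : (forall j, tnth a j != 0) ->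
  ftheta (barnesS_genfun k a)
  = fvar _ * (fconst 'X * barnesS_genfun k a)
    + (\sum_j (1 - fscale (- tnth a j) (fdiv (fvar C) (fexp 1 - 1))))
      * barnesS_genfun k a
    + barnesS_genfun (k - 1) (rcons_tuple a 1)
    - barnesS_genfun k (rcons_tuple a 1).
Proof.
move=> a0; rewrite !barnesS_genfun_rcons1 // !barnesS_genfunE // 2!fthetaM.
rewrite (ftheta_prod _ (fun j => bernF (tnth a j)) _ (fun j => ftheta_bernF _ (a0 j))).
rewrite ftheta_polylogQ (ftheta_exp poly_natS_unit).
by ring.
Qed.

(** * Comparison of coefficients *)

Lemma bernoulli0 : bernoulli C 0 = 1.
Proof.
have := congr1 (fun f : fps C => f 1%N) (bernoulliP C).
rewrite fcoefM big_ord_recl big_ord1 fcoefB fexp_coef0 subrr mul0r add0r.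
by rewrite fcoefB fexp_coef1 subr0 /bernoulli !mul1r.
Qed.

Lemma barnesS_recurrence r k (a : r.-tuple C) n : (forall j, tnth a j != 0) ->
  barnesS k a n.+1 =
    'X * barnesS k a n
    + \sum_(1 <= m < n.+2)
        ((-1) ^+ (m - 1) * 'C(n, m - 1)%:R * bernoulli C m / m%:R) *:
        (\sum_(j < r) (tnth a j) ^+ m *: barnesS k a (n.+1 - m))
    + n.+1%:R^-1 *: barnesS (k - 1) (rcons_tuple a 1) n.+1
    - n.+1%:R^-1 *: barnesS k (rcons_tuple a 1) n.+1.
Proof.
move=> a0.
have := congr1 (fun f : fps _ => f n.+1) (ftheta_barnesS_genfun _ k _ a0).
rewrite /barnesS; move: (barnesS_genfun k a) (barnesS_genfun (k - 1) _).
move: (barnesS_genfun k _) => G2 G G1.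
rewrite fcoefB !fcoefD fcoef_varM fcoef_constM fcoefM => E; rewrite /= in E.
(* Every term thus carries n!, so the claim is n! times [E]; on the left, theta supplies the factor
   n + 1 of (n + 1)!. *)
have nV (x : {poly C}) : n.+1%:R^-1 *: (n.+1`!%:R * x) = n`!%:R * x.
  by rewrite factS natrM -mulrA -mul_polyC -polyCV polyC_natr mulKr ?poly_natS_unit.
rewrite !nV [in LHS]factS natrM mulrAC mulrC E.
rewrite !mulrDr mulrN.
rewrite mulrCA; congr (_ + _ + _ - _).
rewrite big_add1 big_mkord big_ord_recl.
(* As B_0 = 1, the convolution loses its term m = 0 and starts at m = 1. *)
have -> : (\sum_j (1 - fscale (- tnth a j) (fdiv (fvar C) (fexp 1 - 1)))) 0%N = 0.
  rewrite fcoef_sum big1 // => j _; rewrite fcoefB /= mul1r.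
  by have := bernoulli0; rewrite /bernoulli mul1r => ->; rewrite subrr.
rewrite mul0r add0r mulr_sumr; apply: eq_bigr => i _.
have lein : (i <= n)%N by rewrite -ltnS.
rewrite lift0 subSS subn1 /= fcoef_sum mulr_suml mulr_sumr scaler_sumr.
apply: eq_bigr => j _; rewrite fcoefB fcoef1 sub0r [fscale _ _ _]/= -polyCN.
rewrite -!mul_polyC -!polyC_natr !mulrA -!polyCM; congr (_%:P * _).
(* With m = i + 1, n! = binom(n, i) i! (n - i)! and i! = m! / m; the minus sign before B(-a_j t)
   turns (-1)^m into (-1)^(m-1). *)
rewrite /bernoulli -(bin_fact lein) factS !natrM [(- tnth _ _) ^+ _]exprNn !exprS.
by field; rewrite nat1r.
Qed.

End Barnes.

Theorem theorem4 (R : realType) (r : nat) (k : int) (a : r.-tuple R[i]) (n : nat)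
    (hr : (0 < r)%N) (ha : forall j : 'I_r, tnth a j != 0) (hn : (1 <= n)%N) :
  barnesS k a n =
    'X * barnesS k a (n - 1)
    + \sum_(1 <= m < n.+1)
        ((-1) ^+ (m - 1) * 'C(n - 1, m - 1)%:R * bernoulli R[i] m / m%:R) *:
        (\sum_(j < r) (tnth a j) ^+ m *: barnesS k a (n - m))
    + n%:R^-1 *: barnesS (k - 1) (rcons_tuple a 1) n
    - n%:R^-1 *: barnesS k (rcons_tuple a 1) n.
Proof.
case: n hn => // n _; rewrite subn1; apply: barnesS_recurrence ha => m.
by rewrite Num.Theory.pnatr_eq0.
Qed.
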